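(* Let $u_m$ minimize $\|g-Tv\|_Y$ over $v\in V_m$, let $r_m=g-Tu_m$, let $Z_m=T(V_m)$, and let $W_m\subset Z_m^\perp$ be the joint operator-image innovation of the certified candidate pool. Denote its exact aggregate gain by $$G_m^{\mathrm{pool}}=\|P_{W_m}r_m\|_Y^2$$ and suppose a computable lower bound $\underline G_m^{\mathrm{pool}}$ satisfies $$\underline G_m^{\mathrm{pool}}\le G_m^{\mathrm{pool}},\qquad \underline G_m^{\mathrm{pool}}\ge\alpha\|r_m\|_Y^2\quad\text{for some }\alpha>0 .$$ If the selected block or batch has a certified gain $\underline G_m^{\mathrm{sel}}\ge\theta\,\underline G_m^{\mathrm{pool}}$, where $0<\theta\le1$, then $$\|r_{m+1}\|_Y^2\le(1-\theta\alpha)\|r_m\|_Y^2 .$$ Consequently, uniform (in $m$) positive lower bounds for $\alpha$ and $\theta$ imply geometric convergence of $\|r_m\|_Y$ to zero, i.e. geometric convergence in the induced residual norm.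
   Context: $X,Y$ are Hilbert spaces, $T:X\to Y$ is a bounded linear operator (the trial-to-test operator), $g\in Y$, and $V_m\subset X$ is a finite-dimensional trial space. $P_W$ denotes $Y$-orthogonal projection onto $W$. The candidate pool at stage $m$ is a finite family of blocks $C:E_C\to X$ with finite-dimensional coefficient spaces $E_C$. The innovation of a block is $Q_C=(I-P_{Z_m})(T\circ C)$, and the joint operator-image innovation of the pool is $W_m=\sum_{C}Q_C(E_C)\subset Z_m^\perp$, the sum over all blocks in the pool. A selected block or batch $\mathcal B_m$ is a subfamily of the pool; the next trial space is $V_{m+1}=V_m+\sum_{C\in\mathcal B_m}C(E_C)$, and $r_{m+1}=g-Tu_{m+1}$ with $u_{m+1}$ a minimizer of $\|g-Tv\|_Y$ over $V_{m+1}$. A certified gain $\underline G_m^{\mathrm{sel}}$ of the batch is a number that is a lower bound for the exact squared residual reduction: $\underline G_m^{\mathrm{sel}}\le\|r_m\|_Y^2-\|r_{m+1}\|_Y^2$. *)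

(* Defs.v *)
From HB Require Import structures.
From mathcomp Require Import all_boot all_order all_algebra.
From mathcomp Require Import all_classical all_reals all_analysis.
From mathcomp Require Import complex.

Set Implicit Arguments.
Unset Strict Implicit.
Unset Printing Implicit Defensive.

Import Order.TTheory GRing.Theory Num.Theory.
Import numFieldNormedType.Exports.

Local Open Scope classical_set_scope.
Local Open Scope ring_scope.

(* The scalar field is either R or R[i].  Norms take values in the scalar field;
   over R[i] the order relates only numbers with the same imaginary part, so
   that a number comparable with a squared norm is real. *)
Inductive scalars := RealScalars | ComplexScalars.

Definition scalar_field (R : realType) (s : scalars) : numFieldType :=
  match s with RealScalars => R | ComplexScalars => complex R end.

Definition scalar_conj (R : realType) (s : scalars) :
    scalar_field R s -> scalar_field R s :=
  match s with
  | RealScalars => idfun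
  | ComplexScalars => @Num.conj (complex R)
  end.
Arguments scalar_conj : clear implicits.

HB.mixin Record CompleteNormedModule_isHilbert (K : numFieldType)
    (conj : K -> K) H of CompleteNormedModule K H := {
  hdot : {dot H for conj};
  norm_hdot : forall x : H, `|x| ^+ 2 = hdot x x
}.

#[short(type="hilbertType")]
HB.structure Definition Hilbert (K : numFieldType) (conj : K -> K) :=
  {H of CompleteNormedModule K H & CompleteNormedModule_isHilbert K conj H}.

Definition fin_dim_subspace (K : numFieldType) (X : lmodType K) (V : set X) :=
  exists (n : nat) (e : 'I_n -> X),
    V = [set \sum_i a i *: e i | a in [set: 'I_n -> K]].

(* For a finite-dimensional subspace W, exactly one w in W satisfies the
   condition; the default value 0 is then irrelevant. *)
Definition orth_proj (K : numFieldType) (conj : K -> K)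
    (Y : hilbertType conj) (W : set Y) (y : Y) : Y :=
  xget 0 [set w | W w /\ forall z, W z -> hdot (y - w) z = 0].

Record block (K : numFieldType) (X : lmodType K) := Block {
  coefs : vectType K;
  block_map :> {linear coefs -> X}
}.

Section EnrichmentStep.
Variables (K : numFieldType) (conj : K -> K) (X Y : hilbertType conj).
Variables (T : {linear X -> Y}) (g : Y).

Definition residual (u : X) : Y := g - T u.

Definition is_minimizer (V : set X) (u : X) :=
  V u /\ forall v, V v -> `|residual u| <= `|residual v|.

Definition innovation (Z : set Y) (C : block X) (a : coefs C) : Y :=
  T (C a) - orth_proj Z (T (C a)).

Definition pool_innovation (Z : set Y) (I : finType) (pool : I -> block X) :
    set Y :=
  [set \sum_i innovation Z (a i) | a in [set: forall i, coefs (pool i)]].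

Definition next_space (V : set X) (I : finType) (pool : I -> block X)
    (batch : {set I}) : set X :=
  [set v + \sum_(i in batch) pool i (a i) |
     v in V & a in [set: forall i, coefs (pool i)]].

Definition pool_gain (V : set X) (I : finType) (pool : I -> block X) (u : X) :
    K :=
  `|orth_proj (pool_innovation (T @` V) pool) (residual u)| ^+ 2.

(* Gpool and Gsel are the certified lower bounds for the gain of the pool and of
   the batch; u and unext are minimizers on the current and next spaces. *)
Record certified_step (V : set X) (I : finType) (pool : I -> block X)
    (batch : {set I}) (u unext : X) (alpha theta Gpool Gsel : K) : Prop := {
  step_fin_dim : fin_dim_subspace V;
  step_min : is_minimizer V u;
  step_min_next : is_minimizer (next_space V pool batch) unext;
  step_pool_certified : Gpool <= pool_gain V pool u;
  step_alpha_gt0 : 0 < alpha;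
  step_pool_ge : alpha * `|residual u| ^+ 2 <= Gpool;
  step_theta : 0 < theta <= 1;
  step_sel_ge : theta * Gpool <= Gsel;
  step_sel_certified : Gsel <= `|residual u| ^+ 2 - `|residual unext| ^+ 2
}.

End EnrichmentStep.

(* Main.v *)
Require Import Defs.
From HB Require Import structures.
From mathcomp Require Import all_boot all_order all_algebra.
From mathcomp Require Import all_classical all_reals all_analysis.
From mathcomp Require Import complex.
From mathcomp Require Import ring.

(** The certificates chain into one estimate: the batch removes at least
    [theta * Gpool >= theta * alpha * `|r_m| ^+ 2] from the squared residual,
    which is the contraction by [1 - theta * alpha] ([certified_contraction]).

    When [alpha] and [theta] stay above [alpha0] and [theta0], every step
    contracts the squared residual by [1 - t] with [t = theta0 * alpha0].  The
    rate for the residual itself is taken to be [rho = (1 + t / 2)^-1] rather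
    than the square root of [1 - t]: it lies in the unit interval and satisfies
    [1 - t <= rho ^+ 2] for every [t > 0] ([contraction_le_rate_sqr]), whatever
    the sign of [1 - t], and it makes sense in any ordered scalar field.
    The decay [a m <= rho ^+ m * a 0] then follows by induction, and it forces
    convergence to zero because [(1 + t / 2) ^+ m >= 1 + m * (t / 2)] is
    unbounded ([cvg0_of_rate]).  Both scalar fields satisfy the
    Archimedean property that this last step needs ([scalar_archimedean]). *)

Set Implicit Arguments.
Unset Strict Implicit.
Unset Printing Implicit Defensive.

Import Order.TTheory GRing.Theory Num.Theory.
Import numFieldNormedType.Exports.

Local Open Scope classical_set_scope.
Local Open Scope ring_scope.

(** A positive complex number is a positive real number, so the complex case
    reduces to the Archimedean property of the reals. *)
Lemma scalar_archimedean (R : realType) (s : scalars) (x : scalar_field R s) :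
  0 < x -> exists n : nat, x < n%:R.
Proof.
case: s x => /= x x_gt0.
  by exists (Num.bound x); apply: le_lt_trans (archi_boundP (ltW x_gt0)).
case: x x_gt0 => a b; rewrite ltcE /= => /andP[/eqP b0 a_gt0].
exists (Num.bound a).
have -> : (Num.bound a)%:R = (Num.bound a)%:R%:C%C :> complex R.
  by rewrite rmorph_nat.
by rewrite ltcE /= b0 eqxx archi_boundP ?ltW.
Qed.

Section Rate.
Variables (K : numFieldType).
Implicit Types (t d c : K) (a : nat -> K).

Lemma rate_itv d : 0 < d -> 0 <= (1 + d)^-1 < 1.
Proof.
move=> d_gt0; have d1_gt0 : 0 < 1 + d by rewrite addr_gt0.
by rewrite invr_ge0 (ltW d1_gt0) /= invf_lt1 // ltrDl.
Qed.

(** The first-order terms cancel once the denominator is cleared: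
    [(1 - t) * (1 + t / 2) ^+ 2 = 1 - (3 * t ^+ 2 + t ^+ 3) / 4]. *)
Lemma contraction_le_rate_sqr t : 0 < t -> 1 - t <= (1 + t / 2)^-1 ^+ 2.
Proof.
move=> t_gt0; have d_gt0 : 0 < 1 + t / 2 by rewrite addr_gt0 ?divr_gt0.
rewrite exprVn -[leRHS]mul1r ler_pdivlMr ?exprn_gt0 // -subr_ge0.
have -> : 1 - (1 - t) * (1 + t / 2) ^+ 2 = (t ^+ 2 * 3 + t ^+ 3) / 4 by field.
by rewrite divr_ge0 // addr_ge0 ?mulr_ge0 ?exprn_ge0 ?ltW.
Qed.

Lemma geometric_decay (rho : K) a : 0 <= rho -> (forall m, 0 <= a m) ->
  (forall m, a m.+1 ^+ 2 <= rho ^+ 2 * a m ^+ 2) ->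
  forall m, a m <= rho ^+ m * a 0%N.
Proof.
move=> rho_ge0 a_ge0 step; elim=> [|m IHm]; first by rewrite expr0 mul1r.
have a_step : a m.+1 <= rho * a m.
  by rewrite -(ler_pXn2r (n := 2)) ?nnegrE ?mulr_ge0 // exprMn.
by apply: le_trans a_step _; rewrite exprS -mulrA ler_wpM2l.
Qed.

Lemma bernoulli_ineq d m : 0 <= d -> 1 + m%:R * d <= (1 + d) ^+ m.
Proof.
move=> d_ge0; elim: m => [|m IHm]; first by rewrite mul0r addr0 expr0.
apply: le_trans (_ : (1 + d) * (1 + m%:R * d) <= _).
  rewrite -subr_ge0; have -> : (1 + d) * (1 + m%:R * d) - (1 + m.+1%:R * d)
    = m%:R * d ^+ 2 by rewrite -natr1; ring.
  by rewrite mulr_ge0 ?exprn_ge0.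
by rewrite exprS ler_wpM2l ?addr_ge0.
Qed.

(** By Bernoulli's inequality [m * d * a m <= a 0], so [a m < eps] as soon as
    [m] exceeds [(a 0 + 1) / (d * eps)]; adding 1 keeps this bound positive, as
    the Archimedean hypothesis requires, and the final inequality strict. *)
Lemma cvg0_of_rate d a :
  (forall x : K, 0 < x -> exists n : nat, x < n%:R) ->
  0 < d -> (forall m, 0 <= a m) ->
  (forall m, a m <= (1 + d)^-1 ^+ m * a 0%N) ->
  a m @[m --> \oo] --> (0 : K).
Proof.
move=> arch d_gt0 a_ge0 a_le; apply/cvgrPdist_lt => eps eps_gt0.
have [n n_gt] : exists n : nat, (a 0%N + 1) / (d * eps) < n%:R.
  by apply: arch; rewrite divr_gt0 ?mulr_gt0 ?ltr_wpDl.
exists n => // m /= le_nm.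
rewrite sub0r normrN ger0_norm //.
have md_gt0 : 0 < 1 + m%:R * d by rewrite ltr_pwDl // mulr_ge0 // ltW.
have le_a0 : (1 + m%:R * d) * a m <= a 0%N.
  apply: le_trans (_ : (1 + d) ^+ m * a m <= _).
    by rewrite ler_wpM2r ?bernoulli_ineq // ltW.
  have D_gt0 : 0 < (1 + d) ^+ m by rewrite exprn_gt0 // addr_gt0.
  by rewrite mulrC -ler_pdivlMr // mulrC -exprVn.
rewrite -(ltr_pM2l md_gt0); apply: le_lt_trans le_a0 _.
rewrite mulrDl mul1r ltr_wpDl ?ltW //.
apply: lt_le_trans (_ : n%:R * (d * eps) <= _).
  move: n_gt; rewrite ltr_pdivrMr ?mulr_gt0 //.
  by apply: lt_trans; rewrite ltrDl.
by rewrite -mulrA ler_wpM2r ?ler_nat // ltW ?mulr_gt0.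
Qed.

End Rate.

Lemma certified_contraction (K : numFieldType) (conj : K -> K)
    (X Y : hilbertType conj) (T : {linear X -> Y}) (g : Y)
    (V : set X) (I : finType) (pool : I -> block X) (batch : {set I})
    (u unext : X) (alpha theta Gpool Gsel : K) :
  certified_step T g V pool batch u unext alpha theta Gpool Gsel ->
  `|residual T g unext| ^+ 2 <= (1 - theta * alpha) * `|residual T g u| ^+ 2.
Proof.
case=> _ _ _ _ _ pool_ge /andP[theta_gt0 _] sel_ge sel_le.
have gain_ge : theta * (alpha * `|residual T g u| ^+ 2)
    <= `|residual T g u| ^+ 2 - `|residual T g unext| ^+ 2.
  apply: le_trans (le_trans sel_ge sel_le).
  by rewrite ler_wpM2l // ltW.
by rewrite mulrBl mul1r -mulrA lerBrDr addrC -lerBrDr.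
Qed.

Theorem theorem3p5 (R : realType) (s : scalars)
    (X Y : hilbertType (scalar_conj R s)) (T : {linear X -> Y}) (g : Y)
    (T_bounded : bounded_near T (nbhs (0 : X))) :
  (forall (V : set X) (I : finType) (pool : I -> block X) (batch : {set I})
      (u unext : X) (alpha theta Gpool Gsel : scalar_field R s),
    certified_step T g V pool batch u unext alpha theta Gpool Gsel ->
    `|residual T g unext| ^+ 2 <= (1 - theta * alpha) * `|residual T g u| ^+ 2)
  /\
  (forall (V : nat -> set X) (I : nat -> finType)
      (pool : forall m, I m -> block X) (batch : forall m, {set I m})
      (u : nat -> X) (alpha theta Gpool Gsel : nat -> scalar_field R s)
      (alpha0 theta0 : scalar_field R s),
    (forall m, V m.+1 = next_space (V m) (pool m) (batch m)) ->
    (forall m, certified_step T g (V m) (pool m) (batch m) (u m) (u m.+1)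
                 (alpha m) (theta m) (Gpool m) (Gsel m)) ->
    0 < alpha0 -> (forall m, alpha0 <= alpha m) ->
    0 < theta0 -> (forall m, theta0 <= theta m) ->
    (exists rho : scalar_field R s, 0 <= rho < 1 /\
       forall m, `|residual T g (u m)| <= rho ^+ m * `|residual T g (u 0%N)|)
    /\ `|residual T g (u m)| @[m --> \oo] --> (0 : scalar_field R s)).
Proof.
split=> [V I pool batch u unext alpha theta Gpool Gsel|].
  exact: certified_contraction.
move=> V I pool batch u alpha theta Gpool Gsel alpha0 theta0 _ step
  alpha0_gt0 alpha_ge theta0_gt0 theta_ge.
pose t := theta0 * alpha0; pose rho := (1 + t / 2)^-1.
have t_gt0 : 0 < t by rewrite mulr_gt0.
have t2_gt0 : 0 < t / 2 by rewrite divr_gt0.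
have rho_itv : 0 <= rho < 1 by exact: rate_itv.
have decay m : `|residual T g (u m)| <= rho ^+ m * `|residual T g (u 0%N)|.
  apply: (geometric_decay (a := fun m => `|residual T g (u m)|)) => // [|k].
    by case/andP: rho_itv.
  apply: le_trans (certified_contraction (step k)) _.
  rewrite ler_wpM2r ?exprn_ge0 //.
  apply: le_trans (contraction_le_rate_sqr t_gt0).
  by rewrite lerD2l lerN2 ler_pM // ltW.
split; first by exists rho.
exact: (cvg0_of_rate (@scalar_archimedean R s) t2_gt0).
Qed.
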